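(* Let $F$ be a field of characteristic $\neq 2$ and let $R: M_2(F) \to M_2(F)$ be a Rota-Baxter operator on $M_2(F)$ of weight zero. Then, up to conjugation by automorphism, antiautomorphism and up to multiplication by a scalar, $R$ acts in one of the following ways: \begin{enumerate} \item $R(e_{21})=e_{11}$, $R(e_{11})=R(e_{12})=R(e_{22})=0$; \item $R(e_{21})=e_{12}$, $R(e_{11})=R(e_{12})=R(e_{22})=0$; \item $R(e_{21})=e_{11}$, $R(e_{22})=e_{12}$, $R(e_{11})=R(e_{12})=0$; \item $R(e_{21})=-e_{11}$, $R(e_{11})=e_{12}$, $R(e_{12})=R(e_{22})=0$. \end{enumerate}
   Context: Here $M_2(F)$ is the algebra of $2\times 2$ matrices over $F$ and $e_{ij}$ ($i,j\in\{1,2\}$) are its matrix units. If $A$ is an algebra over $F$, a Rota-Baxter operator of weight zero on $A$ is an $F$-linear map $R:A\to A$ such that $R(x)R(y)=R(R(x)y+xR(y))$ for all $x,y\in A$. Conjugation of $R$ by an automorphism or antiautomorphism $\varphi$ of the algebra means passing from $R$ to $\varphi^{-1}R\varphi$; scalars are elements of $F$. *)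

(* Defs.v *)
From HB Require Import structures.
From mathcomp Require Import all_boot all_order all_algebra.

Set Implicit Arguments.
Unset Strict Implicit.
Unset Printing Implicit Defensive.

Import GRing.Theory.
Local Open Scope ring_scope.

Definition rota_baxter_weight0 (F : fieldType) (A : algType F)
    (R : {linear A -> A}) : Prop :=
  forall x y : A, R x * R y = R (R x * y + x * R y).

(* Algebra (anti)automorphisms are F-linear, unital and bijective. *)
Definition alg_automorphism (F : fieldType) (A : algType F)
    (phi : {linear A -> A}) : Prop :=
  [/\ bijective phi, phi 1 = 1 & {morph phi : x y / x * y}].

Definition alg_antiautomorphism (F : fieldType) (A : algType F)
    (phi : {linear A -> A}) : Prop :=
  [/\ bijective phi, phi 1 = 1 & {morph phi : x y / x * y >-> y * x}].

(* R = c phi^-1 S phi for some phi and some c in F. The scalar c may be zero: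
   this only adds R = 0, a Rota-Baxter operator which is a nonzero multiple of
   no nonzero S. *)
Definition conjugate_up_to_scalar (F : fieldType) (A : algType F)
    (R S : {linear A -> A}) : Prop :=
  exists (c : F) (phi : {linear A -> A}) (phi_inv : A -> A),
    [/\ alg_automorphism phi \/ alg_antiautomorphism phi,
        cancel phi phi_inv, cancel phi_inv phi
      & forall x : A, R x = c *: phi_inv (S (phi x))].

(* Matrix units, numbered from 1 whereas 'I_2 = {0, 1}. *)
Notation e11 := (delta_mx (0 : 'I_2) (0 : 'I_2)).
Notation e12 := (delta_mx (0 : 'I_2) (1 : 'I_2)).
Notation e21 := (delta_mx (1 : 'I_2) (0 : 'I_2)).
Notation e22 := (delta_mx (1 : 'I_2) (1 : 'I_2)).

(* Main.v *)
Require Import Defs.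
From HB Require Import structures.
From mathcomp Require Import all_boot all_order all_algebra.
From mathcomp Require Import ring.

Set Implicit Arguments.
Unset Strict Implicit.
Unset Printing Implicit Defensive.

Import GRing.Theory.
Local Open Scope ring_scope.

(** A Rota-Baxter operator [R] of weight zero never takes the value [1], since
[R x = 1] would give [1 = R x * R x = R (2 x) = 2].  Its image is a subalgebra,
and by Cayley-Hamilton a subalgebra of 2 x 2 matrices that contains an
invertible matrix contains [1]; so [R] takes only singular values
([rota_baxter_image_singular]).

A linear space of singular 2 x 2 matrices has a common left kernel vector or a
common right kernel vector ([singular_image_common_kernel]).  After a
transposition in the second case, and a conjugation that moves the left kernel
vector to [(0, 1)], every value of the operator has zero second row
([rota_baxter_to_first_row]).

Such an operator is given by the eight coordinates of its values on the matrix
units, and the Rota-Baxter identity on pairs of matrix units is a system of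
quadratic equations in them.  The equations at [e11] and [e12] say that the
restriction of [R] to the right ideal spanned by [e11] and [e12] is nilpotent.
If [R e12 <> 0], the other values are forced to be multiples of [R e12], and a
unipotent conjugation followed by a transposition leads to the first normal
form.  If [R e12 = 0], then [R e11] is a multiple of [e12], and the remaining
equations leave four families, distinguished by the vanishing of [R e11],
[R e22] and the [e11]-coordinate of [R e21]: they give the four normal forms,
with [R = 0] as the zero multiple of the second one
([first_row_rota_baxter_has_normal_form]). *)

(** * Conjugation by automorphisms and antiautomorphisms *)

Section Conjugation.

Variables (F : fieldType) (A : algType F).
Implicit Types (R S T phi psi : {linear A -> A}).

Definition alg_symmetry phi := alg_automorphism phi \/ alg_antiautomorphism phi.

Lemma alg_symmetry_comp phi psi :
  alg_symmetry phi -> alg_symmetry psi -> alg_symmetry (psi \o phi).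
Proof.
move=> [] [bf f1 fM] [] [bg g1 gM]; [left|right|right|left]; split;
  rewrite /= ?f1 ?g1 //; try exact: bij_comp; by move=> x y; rewrite /= fM gM.
Qed.

Lemma conjugate_trans R S T :
    conjugate_up_to_scalar R S -> conjugate_up_to_scalar S T ->
  conjugate_up_to_scalar R T.
Proof.
move=> [c [f [f' [fS fK f'K RE]]]] [d [g [g' [gS gK g'K SE]]]].
exists (c * d), (g \o f), (f' \o g'); split.
- exact: alg_symmetry_comp.
- exact: can_comp.
- exact: can_comp.
- move=> x; have f'Z : scalable f' := can2_scalable fK f'K.
  by rewrite RE SE f'Z scalerA.
Qed.

(** Exchanging [x] and [y] turns the Rota-Baxter identity into the identity for
the opposite product, so antiautomorphisms preserve it like automorphisms. *)
Lemma conjugate_by_symmetry R phi psi :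
    rota_baxter_weight0 R -> alg_symmetry phi ->
    cancel phi psi -> cancel psi phi ->
  rota_baxter_weight0 (phi \o R \o psi) /\
  conjugate_up_to_scalar R (phi \o R \o psi).
Proof.
move=> RB fS fK psiK; split; last first.
  by exists 1, phi, psi; split=> // x; rewrite /= scale1r !fK.
move=> x y; rewrite /=.
case: fS => -[_ _ fM]; rewrite -fM RB; congr (phi (R _)); apply: (can_inj fK);
  by rewrite psiK !raddfD /= !fM !psiK // addrC.
Qed.

Lemma scalar_conjugate R S (c : F) :
  (forall x, R x = c *: S x) -> conjugate_up_to_scalar R S.
Proof.
move=> RE; exists c, idfun, id; split=> //; left.
by split=> //; exists id.
Qed.

(** If [R x = 1], the Rota-Baxter identity at [(x, x)] reads
[1 = R (x + x) = 1 + 1]. *)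
Lemma one_notin_image R x : rota_baxter_weight0 R -> R x != 1.
Proof.
move=> RB; apply/eqP=> Rx; have := RB x x.
rewrite Rx !mul1r mulr1 raddfD /= Rx => /eqP.
by rewrite -subr_eq0 opprD addrA subrr add0r oppr_eq0 oner_eq0.
Qed.

End Conjugation.

(** * Singular values of the operator *)

Section TwoByTwo.

Variable F : fieldType.
Implicit Types a b : 'M[F]_2.

Lemma ord2E (i : 'I_2) : i = 0 \/ i = 1.
Proof. by case: i => [[|[|//]] p]; [left|right]; apply: val_inj. Qed.

Lemma mulmx2E p q (a : 'M[F]_(p, 2)) (b : 'M[F]_(2, q)) i j :
  (a *m b) i j = a i 0 * b 0 j + a i 1 * b 1 j.
Proof.
rewrite mxE !big_ord_recl big_ord0 addr0.
by congr (_ + _ i _ * b _ _); apply: val_inj.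
Qed.

Lemma mx2P a b : a 0 0 = b 0 0 -> a 0 1 = b 0 1 -> a 1 0 = b 1 0 ->
  a 1 1 = b 1 1 -> a = b.
Proof.
move=> h00 h01 h10 h11; apply/matrixP=> i j.
by case: (ord2E i) => ->; case: (ord2E j) => ->.
Qed.

Lemma mx2_expand a :
  a = a 0 0 *: e11 + a 0 1 *: e12 + a 1 0 *: e21 + a 1 1 *: e22.
Proof. by apply: mx2P; rewrite !mxE /=; ring. Qed.

Lemma mxtrace2E a : \tr a = a 0 0 + a 1 1.
Proof.
rewrite /mxtrace !big_ord_recl big_ord0 addr0.
by congr (_ + a _ _); apply: val_inj.
Qed.

Lemma det2E a : \det a = a 0 0 * a 1 1 - a 0 1 * a 1 0.
Proof.
rewrite (expand_det_row _ 0) !big_ord_recl big_ord0 addr0 /cofactor.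
rewrite !det_mx11 !mxE /=.
rewrite (_ : lift 0 0 = 1); last exact: val_inj.
rewrite (_ : lift 1 0 = 0) ?expr0 ?expr1; last exact: val_inj.
by ring.
Qed.

Lemma Cayley_Hamilton2 a : a *m a = \tr a *: a - \det a *: 1.
Proof.
by apply: mx2P; rewrite mulmx2E !mxE mxtrace2E det2E /=; ring.
Qed.

(** The image is a subalgebra: [R x * R x = R (R x * x + x * R x)].  By
Cayley-Hamilton it then contains [\det (R x) *: 1]. *)
Lemma rota_baxter_image_singular (R : {linear 'M[F]_2 -> 'M[F]_2}) x :
  rota_baxter_weight0 R -> \det (R x) = 0.
Proof.
move=> RB; apply/eqP/negPn/negP=> d_neq0.
pose y := \tr (R x) *: x - (R x * x + x * R x).
have /eqP[] := one_notin_image ((\det (R x))^-1 *: y) RB.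
rewrite /y linearZ linearB linearZ /= -RB.
rewrite -[R x * R x]/(R x *m R x) Cayley_Hamilton2 subKr.
by rewrite scalerA mulVf // scale1r.
Qed.

(** The adjugate, with its entries written out for computation. *)
Definition adj2 a : 'M[F]_2 :=
  a 1 1 *: e11 - a 0 1 *: e12 - a 1 0 *: e21 + a 0 0 *: e22.

Lemma adj2_eq0 a : adj2 a = 0 -> a = 0.
Proof.
move=> a0; apply: mx2P.
- by have /matrixP/(_ 1 1) := a0; rewrite !mxE /= => <-; ring.
- have /matrixP/(_ 0 1) := a0; rewrite !mxE /= => H.
  by apply: oppr_inj; rewrite oppr0 -H; ring.
- have /matrixP/(_ 1 0) := a0; rewrite !mxE /= => H.
  by apply: oppr_inj; rewrite oppr0 -H; ring.
- by have /matrixP/(_ 0 0) := a0; rewrite !mxE /= => <-; ring.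
Qed.

(** Polarizing [a *m adj2 a = \det a *: 1] gives
[b *m adj2 a + a *m adj2 b = (\det (a + b) - \det a - \det b) *: 1], which is
then multiplied by [b] on the right.  On a linear space of singular matrices the
right-hand side of the result vanishes. *)
Lemma adj2_sandwich a b :
  b *m adj2 a *m b = (\det (a + b) - \det a - \det b) *: b - \det b *: a.
Proof. by apply: mx2P; rewrite !mulmx2E !mxE !det2E !mxE /=; ring. Qed.

(** A singular 2 x 2 matrix has rank at most one, so it is, up to an entry, the
product of its column and its row through that entry. *)
Lemma singular_col_row a k l : \det a = 0 -> col l a *m row k a = a k l *: a.
Proof.
rewrite det2E => /eqP; rewrite subr_eq0 => /eqP d.
apply/matrixP=> i j; rewrite mxE big_ord1 !mxE.
by case: (ord2E i) => ->; case: (ord2E j) => ->;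
   case: (ord2E k) => ->; case: (ord2E l) => ->; ring: d.
Qed.

Lemma mul_col_row_eq0 p q (u : 'cV[F]_p) (v : 'rV[F]_q) :
  u *m v = 0 -> u = 0 \/ v = 0.
Proof.
move=> uv0; have [->|/cV0Pn[i ui]] := eqVneq u 0; [by left | right].
apply/rowP=> j; have /matrixP/(_ i j)/eqP := uv0.
by rewrite !mxE big_ord1 mulf_eq0 (negPf ui) => /eqP.
Qed.

End TwoByTwo.

Section LinearAlternatives.

Variable F : fieldType.
Implicit Types V U W : vectType F.

Lemma linear_eq0_or V U (f : {linear V -> U}) :
  (forall x, f x = 0) \/ exists x, f x != 0.
Proof.
have [/subvP kerT|/subvPn[x _]] := boolP (fullv <= lker (linfun f))%VS.
  by left=> x; have := kerT x (memvf x); rewrite memv_ker lfunE => /eqP.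
by rewrite memv_ker lfunE; right; exists x.
Qed.

(** A vector space is not the union of two proper subspaces, here the kernels of
[f] and [g]. *)
Lemma linear_eq0_alternative V U W (f : {linear V -> U}) (g : {linear V -> W}) :
    (forall x, f x = 0 \/ g x = 0) ->
  (forall x, f x = 0) \/ (forall x, g x = 0).
Proof.
move=> fg0; have [|[x fx]] := linear_eq0_or f; first by left.
have [|[y gy]] := linear_eq0_or g; first by right.
have gx : g x = 0 by case: (fg0 x) => // fx0; rewrite fx0 eqxx in fx.
have fy : f y = 0 by case: (fg0 y) => // gy0; rewrite gy0 eqxx in gy.
case: (fg0 (x + y)); rewrite linearD ?fy ?gx ?addr0 ?add0r => h0.
  by rewrite h0 eqxx in fx.
by rewrite h0 eqxx in gy.
Qed.

End LinearAlternatives.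

Section Kernel.

Variable F : fieldType.

(** Fix a nonzero value [R x0], and let [z *m w] be proportional to its adjugate.
For every value [m] one gets [m *m z *m w *m m = 0], that is [m *m z = 0] or
[w *m m = 0].  The values with the first property and those with the second form
two subspaces, so one of the two properties holds throughout. *)
Lemma singular_image_common_kernel (V : vectType F) (R : {linear V -> 'M[F]_2}) :
    (forall x, \det (R x) = 0) ->
  (exists2 w : 'rV_2, w != 0 & forall x, w *m R x = 0) \/
  (exists2 z : 'cV_2, z != 0 & forall x, R x *m z = 0).
Proof.
move=> Rsing; have [R0|[x0 Rx0]] := linear_eq0_or R.
  left; exists (delta_mx 0 0); last by move=> x; rewrite R0 mulmx0.
  by apply/rV0Pn; exists 0; rewrite mxE /= oner_eq0.
set b := adj2 (R x0).
have /matrix0Pn[k [l bkl]] : b != 0 by apply: contra Rx0 => /eqP/adj2_eq0->.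
have w0 : row k b != 0 by apply/rV0Pn; exists l; rewrite mxE.
have z0 : col l b != 0 by apply/cV0Pn; exists k; rewrite mxE.
have b_sing : \det b = 0.
  have := Rsing x0; rewrite !det2E !mxE /= => <-; ring.
have [] := @linear_eq0_alternative _ _ _ _
    (mulmx (row k b) \o R) (mulmxr (col l b) \o R).
- move=> x /=.
  have /mul_col_row_eq0[] : (R x *m col l b) *m (row k b *m R x) = 0.
  + rewrite mulmxA -[R x *m _ *m _]mulmxA singular_col_row //.
    rewrite -scalemxAr -scalemxAl.
    by rewrite adj2_sandwich -linearD !Rsing !subr0 !scale0r subr0 scaler0.
  + by right.
  + by left.
- by left; exists (row k b).
- by right; exists (col l b).
Qed.

End Kernel.

(** * Moving the image into the first row *)

Section Normalization.

Variable F : fieldType.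
Implicit Types (R S T phi psi : {linear 'M[F]_2 -> 'M[F]_2}) (P Q : 'M[F]_2).

Definition mxtr : {linear 'M[F]_2 -> 'M[F]_2} := trmx.
Definition mxconj P Q : {linear 'M[F]_2 -> 'M[F]_2} := mulmx P \o mulmxr Q.

Lemma mxtr_symmetry : alg_symmetry mxtr.
Proof.
right; split; first by exists trmx; exact: trmxK.
- exact: trmx1.
- exact: trmx_mul.
Qed.

Lemma mxconjK P Q : Q *m P = 1%:M -> cancel (mxconj P Q) (mxconj Q P).
Proof. by move=> QP x; rewrite /= !mulmxA QP mul1mx -mulmxA QP mulmx1. Qed.

Lemma mxconj_symmetry P Q : Q *m P = 1%:M -> alg_symmetry (mxconj P Q).
Proof.
move=> QP; have PQ := mulmx1C QP; left; split.
- by exists (mxconj Q P); apply: mxconjK.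
- by rewrite /= mul1mx.
- move=> x y; rewrite /= -[x * y]/(x *m y) -[_ * _ in RHS]/(_ *m _).
  by rewrite !mulmxA -[P *m x *m Q *m P]mulmxA QP mulmx1.
Qed.

Lemma row_extends_to_unit (w : 'rV[F]_2) :
  w != 0 -> exists2 P, P \in unitmx & row 1 P = w.
Proof.
(* The first row is (c, 1 - c), where c = 1 or c = 0 makes it independent of w. *)
move=> w0; pose P c := c *: e11 + (1 - c) *: e12 + w 0 0 *: e21 + w 0 1 *: e22.
have PE c : row 1 (P c) = w.
  apply/rowP=> j; rewrite !mxE.
  by case: (ord2E j) => -> /=; rewrite !mulr0 mulr1 ?add0r ?addr0.
have dP c : \det (P c) = c * w 0 1 - (1 - c) * w 0 0.
  by rewrite det2E !mxE /=; ring.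
case: (eqVneq (w 0 1) 0) => w1; last first.
  by exists (P 1); rewrite // unitmxE dP subrr mul1r mul0r subr0 unitfE.
exists (P 0) => //; rewrite unitmxE dP mul0r subr0 mul1r sub0r unitfE oppr_eq0.
apply: contra w0 => /eqP w00; apply/eqP/rowP=> j; rewrite mxE.
by case: (ord2E j) => ->.
Qed.

(** If [row 1 P = w] and [w] kills every value of [T] on the left, then
[P *m T x *m invmx P] has zero second row.  A right kernel vector becomes a left
one by transposition. *)
Lemma rota_baxter_to_first_row R :
    rota_baxter_weight0 R ->
  exists T, [/\ rota_baxter_weight0 T, conjugate_up_to_scalar R T
              & forall x, row 1 (T x) = 0].
Proof.
have left_kernel T (w : 'rV_2) : rota_baxter_weight0 T -> w != 0 ->
    (forall x, w *m T x = 0) ->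
    exists T', [/\ rota_baxter_weight0 T', conjugate_up_to_scalar T T'
              & forall x, row 1 (T' x) = 0].
  move=> TB w0 wT; have [P Pu Pw] := row_extends_to_unit w0.
  have [TB' TT'] := conjugate_by_symmetry TB (mxconj_symmetry (mulVmx Pu))
    (mxconjK (mulVmx Pu)) (mxconjK (mulmxV Pu)).
  exists (mxconj P (invmx P) \o T \o mxconj (invmx P) P); split=> // x /=.
  by rewrite row_mul Pw mulmxA wT mul0mx.
move=> RB.
have [[w w0 wR]|[z z0 Rz]] :=
  singular_image_common_kernel (fun x => rota_baxter_image_singular x RB).
  exact: left_kernel wR.
have trK : cancel mxtr mxtr by move=> x; exact: trmxK.
have [TB RT] := conjugate_by_symmetry RB mxtr_symmetry trK trK.
have [|x|T [TB' TT' T0]] := @left_kernel _ (z^T) TB.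
- by rewrite trmx_eq0.
- by rewrite /= -trmx_mul Rz trmx0.
- by exists T; split=> //; exact: conjugate_trans TT'.
Qed.

(** * Operators that reach a normal form by a unipotent conjugation *)

Definition normal_form S : Prop :=
  [\/ [/\ S e21 = e11, S e11 = 0, S e12 = 0 & S e22 = 0],
      [/\ S e21 = e12, S e11 = 0, S e12 = 0 & S e22 = 0],
      [/\ S e21 = e11, S e22 = e12, S e11 = 0 & S e12 = 0]
    | [/\ S e21 = - e11, S e11 = e12, S e12 = 0 & S e22 = 0]].

Definition has_normal_form R :=
  exists S, conjugate_up_to_scalar R S /\ normal_form S.

Lemma rescaled_has_normal_form R (c : F) :
  c != 0 -> normal_form (c^-1 \*: R) -> has_normal_form R.
Proof.
move=> c0 nf; exists (c^-1 \*: R); split=> //.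
by apply: (@scalar_conjugate _ _ _ _ c) => x; rewrite /= scalerA mulfV // scale1r.
Qed.

Lemma linear_mx2E T x : T x = x 0 0 *: T e11 + x 0 1 *: T e12
                            + x 1 0 *: T e21 + x 1 1 *: T e22.
Proof. by rewrite {1}(mx2_expand x) !linearD !linearZ. Qed.

(** Conjugations by these matrices preserve the span of [e11] and [e12], and so
the condition that the operator takes its values there. *)
Definition unip (t : F) : 'M[F]_2 := 1 + t *: e12.

Lemma unipNK t : unip (- t) *m unip t = 1%:M.
Proof. by apply: mx2P; rewrite mulmx2E !mxE /=; ring. Qed.

(** The first two normal forms, for [j = 0] and [j = 1], as [x |-> e12 x e1j]. *)
Definition corner_to (j : 'I_2) : {linear 'M[F]_2 -> 'M[F]_2} :=
  mulmx e12 \o mulmxr (delta_mx 0 j).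

Lemma corner_toE j (x : 'M_2) : corner_to j x = x 1 0 *: delta_mx 0 j.
Proof.
case: j => [[|[|//]] p]; apply: mx2P;
  by rewrite /= !(mulmx2E, mxE) /=; ring.
Qed.

Lemma unip_conj_e11 t : mxconj (unip (- t)) (unip t) e11 = e11 + t *: e12.
Proof. by apply: mx2P; rewrite /= !(mulmx2E, mxE) /=; ring. Qed.

Lemma unip_conj_10 t (x : 'M_2) : mxconj (unip t) (unip (- t)) x 1 0 = x 1 0.
Proof. by rewrite /= !(mulmx2E, mxE) /=; ring. Qed.

Lemma unip_conj_01 t (x : 'M_2) : mxconj (unip (- t)) (unip t) x 0 1 =
  x 0 1 + t * (x 0 0 - x 1 1) - t ^+ 2 * x 1 0.
Proof. by rewrite /= !(mulmx2E, mxE) /=; ring. Qed.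

(** When [u1 <> 0], conjugation by [unip (u2 / u1)] preserves the functional
[x |-> x 1 0], and its inverse moves [e11] to [e11 + (u2 / u1) *: e12]; when
[u1 = 0] the operator is already a multiple of the second normal form. *)
Lemma e21_only_has_normal_form R u1 u2 :
  (forall x, R x = x 1 0 *: (u1 *: e11 + u2 *: e12)) -> has_normal_form R.
Proof.
move=> RE; case: (eqVneq u1 0) => [u1_0|u1_neq0].
  exists (corner_to 1); split.
    apply: (@scalar_conjugate _ _ _ _ u2) => x.
    by rewrite RE u1_0 scale0r add0r corner_toE !scalerA mulrC.
  by constructor 2; split; rewrite corner_toE mxE /= ?scale1r ?scale0r.
exists (corner_to 0); split; last first.
  by constructor 1; split; rewrite corner_toE mxE /= ?scale1r ?scale0r.
pose t := u2 / u1; have u2E : u2 = u1 * t by rewrite mulrC divfK.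
exists u1, (mxconj (unip t) (unip (- t))), (mxconj (unip (- t)) (unip t)); split.
- exact/mxconj_symmetry/unipNK.
- exact/mxconjK/unipNK.
- exact/mxconjK/mulmx1C/unipNK.
- move=> x; rewrite RE corner_toE unip_conj_10 linearZ.
  by rewrite unip_conj_e11 u2E -scalerA -scalerDr !scalerA mulrC.
Qed.

(** The functional of [x] in the formula is the [(0, 1)] entry of
[unip (- t) *m x *m unip t].  The transposition turns it into the [(1, 0)] entry,
which the first normal form sends to [e11]; undoing the conjugation sends
[e11] to [e11 - t *: e12]. *)
Lemma rank_one_has_normal_form R c t :
    (forall x, R x = (c * (x 0 1 + t * (x 0 0 - x 1 1) - t ^+ 2 * x 1 0)) *:
                       (e11 - t *: e12)) ->
  has_normal_form R.
Proof.
move=> RE; exists (corner_to 0); split; last first.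
  by constructor 1; split; rewrite corner_toE mxE /= ?scale1r ?scale0r.
pose phi : {linear 'M[F]_2 -> 'M[F]_2} :=
  mxtr \o mxconj (unip (- t)) (unip t).
pose psi : {linear 'M[F]_2 -> 'M[F]_2} :=
  mxconj (unip t) (unip (- t)) \o mxtr.
have phi10 x : phi x 1 0 = x 0 1 + t * (x 0 0 - x 1 1) - t ^+ 2 * x 1 0.
  by rewrite -unip_conj_01 mxE.
have psi_e11 : psi e11 = e11 - t *: e12.
  have := unip_conj_e11 (- t); rewrite opprK scaleNr => <-.
  by rewrite /psi /= trmx_delta.
have NK := unipNK t; have KN := mulmx1C NK.
exists c, phi, psi; split.
- exact: alg_symmetry_comp (mxconj_symmetry KN) mxtr_symmetry.
- apply: can_comp; [exact: trmxK | exact: mxconjK].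
- apply: can_comp; [exact: mxconjK | exact: trmxK].
- by move=> x; rewrite RE corner_toE (linearZ_LR psi) psi_e11 phi10 scalerA.
Qed.

(** * The quadratic equations for operators with values in the first row *)

(** The Rota-Baxter identity in coordinates.  The four coefficients of
[T e11], ..., [T e22] are the entries of [T x * y + x * T y]; the product
[T x * T y] equals [T x 0 0 *: T y] because the second row of [T y] is zero. *)
Lemma first_row_rota_baxter_eqs T :
    rota_baxter_weight0 T -> (forall x, row 1 (T x) = 0) ->
  forall (x y : 'M_2) (j : 'I_2),
      (T x 0 0 * y 0 0 + T x 0 1 * y 1 0 + x 0 0 * T y 0 0) * T e11 0 j
    + (T x 0 0 * y 0 1 + T x 0 1 * y 1 1 + x 0 0 * T y 0 1) * T e12 0 j
    + x 1 0 * T y 0 0 * T e21 0 j + x 1 0 * T y 0 1 * T e22 0 j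
    - T x 0 0 * T y 0 j = 0.
Proof.
move=> TB T0 x y j.
have T1 z k : T z 1 k = 0 by have /rowP/(_ k) := T0 z; rewrite !mxE.
have TE z : T z 0 j = z 0 0 * T e11 0 j + z 0 1 * T e12 0 j
                      + z 1 0 * T e21 0 j + z 1 1 * T e22 0 j.
  by rewrite [in LHS]linear_mx2E !mxE.
have /matrixP/(_ 0 j) := TB x y; rewrite (TE (T x * y + x * T y)).
have zE p q : (T x * y + x * T y) p q = (T x *m y) p q + (x *m T y) p q.
  by rewrite mxE.
rewrite !zE -[T x * T y]/(T x *m T y) !mulmx2E !T1 mulr0 addr0 => ->.
ring.
Qed.

(** The cases are distinguished by the first nonzero coordinate among [a12], [b11]
and [b22]: it is a factor of enough of the equations to express all the other
coordinates in terms of it.  If all three vanish, so does [T] on [e11], [e12] and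
[e22]; this last case contains [T = 0]. *)
Lemma first_row_rota_baxter_has_normal_form T :
    rota_baxter_weight0 T -> (forall x, row 1 (T x) = 0) -> has_normal_form T.
Proof.
move=> TB T0.
have T1 z k : T z 1 k = 0 by have /rowP/(_ k) := T0 z; rewrite !mxE.
have Trow z : T z = T z 0 0 *: e11 + T z 0 1 *: e12.
  by apply: mx2P; rewrite ?T1 !mxE /=; ring.
pose a11 := T e11 0 0; pose b11 := T e11 0 1.
pose a12 := T e12 0 0; pose b12 := T e12 0 1.
pose a21 := T e21 0 0; pose b21 := T e21 0 1.
pose a22 := T e22 0 0; pose b22 := T e22 0 1.
have TE x : T x =
    (a11 * x 0 0 + a12 * x 0 1 + a21 * x 1 0 + a22 * x 1 1) *: e11
  + (b11 * x 0 0 + b12 * x 0 1 + b21 * x 1 0 + b22 * x 1 1) *: e12.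
  rewrite [LHS]Trow (linear_mx2E T x) !mxE -/a11 -/b11 -/a12 -/b12 -/a21 -/b21.
  by rewrite -/a22 -/b22; congr (_ *: _ + _ *: _); ring.
have eqs := first_row_rota_baxter_eqs TB T0.
(* In the names of the equations aa and ab stand for the first and the second
   coordinate, and the digits for the pair of matrix units.  The matrix with rows
   (a11, b11) and (a12, b12) represents T on the span of e11 and e12; the first
   three equations make it nilpotent. *)
have aa1111 : a11 ^+ 2 + a12 * b11 = 0.
  by rewrite -(eqs e11 e11 0) !mxE /= -/a11 -/b11 -/a12; ring.
have aa1112 : a12 * (a11 + b12) = 0.
  by rewrite -(eqs e11 e12 0) !mxE /= -/a11 -/b11 -/a12 -/b12; ring.
have ab1112 : b12 ^+ 2 + a12 * b11 = 0.
  by rewrite -(eqs e11 e12 1) !mxE /= -/a11 -/b11 -/a12 -/b12; ring.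
have [a12_0|a12_neq0] := eqVneq a12 0; last first.
  (* Each remaining coordinate enters, multiplied by a12, an equation whose first
     argument is e11 or e12. *)
  have b12E : b12 = - a11.
    have /eqP := aa1112.
    by rewrite mulf_eq0 (negPf a12_neq0) addrC addr_eq0 => /eqP.
  pose t := a11 / a12; have a11E : a11 = a12 * t by rewrite mulrC divfK.
  have cancel_a12 u v : a12 * u - a12 * v = 0 -> u = v.
    by move/subr0_eq/(mulfI a12_neq0).
  apply: (@rank_one_has_normal_form _ a12 t) => x; rewrite TE.
  have b11E : b11 = - (a12 * t ^+ 2).
    by apply: cancel_a12; rewrite -aa1111 a11E; ring.
  have a22E : a22 = - a11.
    apply: cancel_a12; rewrite -oppr0 -(eqs e12 e22 0) !mxE /= -/a12 -/b12 -/a22.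
    by rewrite b12E; ring.
  have b22E : b22 = a11 * t.
    apply: cancel_a12; rewrite -oppr0 -(eqs e12 e22 1) !mxE /= -/a12 -/b12 -/b22.
    by rewrite b12E a11E; ring.
  have a21E : a21 = - (a11 * t).
    apply: cancel_a12; rewrite -oppr0 -(eqs e12 e21 0) !mxE /=.
    by rewrite -/a11 -/a12 -/b12 -/a21 b12E a11E; ring.
  have b21E : b21 = a11 * t ^+ 2.
    apply: cancel_a12; rewrite -oppr0 -(eqs e12 e21 1) !mxE /=.
    by rewrite -/b11 -/a12 -/b12 -/b21 b12E b11E a11E; ring.
  rewrite b11E b12E a21E b21E a22E b22E a11E.
  by apply: mx2P; rewrite !mxE /=; ring.
(* In the remaining case T e12 = 0 and T e11 = b11 e12. *)
have b12_0 : b12 = 0.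
  by move/eqP: ab1112; rewrite a12_0 mul0r addr0 sqrf_eq0 => /eqP.
have a11_0 : a11 = 0.
  by move/eqP: aa1111; rewrite a12_0 mul0r addr0 sqrf_eq0 => /eqP.
have folds := (a11_0, a12_0, b12_0).
have a22_0 : a22 = 0.
  apply/eqP; rewrite -sqrf_eq0 -oppr_eq0 -(eqs e22 e22 0) !mxE /=.
  by rewrite -/a11 -/a12 -/a21 -/b22 -/a22 !folds; apply/eqP; ring.
have ab1121 : b11 * (b11 + a21) = 0.
  rewrite -(eqs e11 e21 1) !mxE /= -/a11 -/b11 -/a21 -/b21 -/b12 -/a12 !folds.
  by ring.
have ab2121 : b21 * (b11 + b22) = 0.
  rewrite -(eqs e21 e21 1) !mxE /= -/b11 -/a21 -/b21 -/b12 -/b22 !folds.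
  by ring.
have ab2122 : b22 * (b22 - a21) = 0.
  rewrite -(eqs e21 e22 1) !mxE /= -/b11 -/a21 -/b21 -/b12 -/b22 -/a22.
  by rewrite a22_0 !folds; ring.
have ab2221 : b22 * b11 = 0.
  rewrite -(eqs e22 e21 1) !mxE /= -/b11 -/a21 -/b21 -/b12 -/b22 -/a22.
  by rewrite a22_0 !folds; ring.
have [b11_0|b11_neq0] := eqVneq b11 0; last first.
  have b22_0 : b22 = 0.
    by move/eqP: ab2221; rewrite mulf_eq0 (negPf b11_neq0) orbF => /eqP.
  have a21E : a21 = - b11.
    move/eqP: ab1121.
    by rewrite mulf_eq0 (negPf b11_neq0) addrC addr_eq0 => /eqP.
  have b21_0 : b21 = 0.
    move/eqP: ab2121.
    by rewrite b22_0 addr0 mulf_eq0 (negPf b11_neq0) orbF => /eqP.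
  apply: (rescaled_has_normal_form b11_neq0); constructor 4.
  split; apply: mx2P;
    by rewrite /= TE a21E a22_0 b22_0 b21_0 !folds !mxE /=; field.
have [b22_0|b22_neq0] := eqVneq b22 0.
  apply: (@e21_only_has_normal_form _ a21 b21) => x.
  by apply: mx2P; rewrite TE a22_0 b11_0 b22_0 !folds !mxE /=; ring.
have a21E : a21 = b22.
  by move/eqP: ab2122; rewrite mulf_eq0 (negPf b22_neq0) subr_eq0 eq_sym => /eqP.
have b21_0 : b21 = 0.
  by move/eqP: ab2121; rewrite b11_0 add0r mulf_eq0 (negPf b22_neq0) orbF => /eqP.
apply: (rescaled_has_normal_form b22_neq0); constructor 3.
split; apply: mx2P;
  by rewrite /= TE a21E a22_0 b11_0 b21_0 !folds !mxE /=; field.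
Qed.

End Normalization.

Theorem proposition18 (F : fieldType) (charF : 2%N \notin [pchar F])
    (R : {linear 'M[F]_2 -> 'M[F]_2}) (RB : rota_baxter_weight0 R) :
  exists S : {linear 'M[F]_2 -> 'M[F]_2},
    conjugate_up_to_scalar R S /\
    [\/ [/\ S e21 = e11, S e11 = 0, S e12 = 0 & S e22 = 0],
        [/\ S e21 = e12, S e11 = 0, S e12 = 0 & S e22 = 0],
        [/\ S e21 = e11, S e22 = e12, S e11 = 0 & S e12 = 0]
      | [/\ S e21 = - e11, S e11 = e12, S e12 = 0 & S e22 = 0]].
Proof.
have [T [TB RT T0]] := rota_baxter_to_first_row RB.
have [S [TS Snf]] := first_row_rota_baxter_has_normal_form TB T0.
by exists S; split; [exact: conjugate_trans TS | exact: Snf].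
Qed.
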